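(* Let $d,n_1,\dots,n_d$ be positive integers and let $f:[\overline{n};d]\to\mathbb{F}_2$. Let $\varepsilon$ be the probability that the Shapka test rejects $f$, i.e. \[\varepsilon=\Pr_{a,b}\Bigl[f(b)\oplus\bigoplus_{j=1}^d f(a_b^j)\oplus [d\text{ even}]\,f(a)=1\Bigr],\] where $a,b$ are independent and uniform in $[\overline{n};d]$, and the term $f(a)$ is included iff $d$ is even. Then there is a direct sum $g:[\overline{n};d]\to\mathbb{F}_2$ with $\Pr_{x}[f(x)\neq g(x)]\le\varepsilon$ ($x$ uniform in $[\overline{n};d]$).
   Context: For a positive integer $n$, $[n]=\{0,1,\dots,n\}$ and $[\overline{n};d]=[n_1]\times\cdots\times[n_d]$. For $a,b\in[\overline{n};d]$ and $j\in\{1,\dots,d\}$, $a_b^j$ is the vector equal to $a$ in every coordinate except the $j$-th, where it equals $b_j$. The sum in the test is taken over the listed terms with multiplicity (terms are not merged if some $a_b^j$ coincide with each other or with $a$ or $b$). A function $g:[\overline{n};d]\to\mathbb{F}_2$ is a direct sum if $g(x)=g_1(x_1)\oplus\cdots\oplus g_d(x_d)$ for some $g_i:[n_i]\to\mathbb{F}_2$. *)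

(* Defs.v *)
From mathcomp Require Import all_boot all_order all_algebra.

Set Implicit Arguments.
Unset Strict Implicit.
Unset Printing Implicit Defensive.

Import GRing.Theory Num.Theory.
Local Open Scope ring_scope.

(* [n_1] x ... x [n_d] with [m] = {0, ..., m}, hence the successor. *)
Definition grid (d : nat) (n : 'I_d -> nat) : finType :=
  {dffun forall i : 'I_d, 'I_(n i).+1}.

Definition prob (T : finType) (E : pred T) : rat := #|E|%:R / #|T|%:R.

(* Written a_b^j in the paper: a with its j-th coordinate taken from b. *)
Definition replace_coord (d : nat) (n : 'I_d -> nat) (a b : grid n) (j : 'I_d) :
    grid n :=
  [ffun i => if i == j then b i else a i].

Definition direct_sum (d : nat) (n : 'I_d -> nat) (g : grid n -> 'F_2) : Prop :=
  exists h : forall i : 'I_d, 'I_(n i).+1 -> 'F_2,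
    forall x : grid n, g x = \sum_(i < d) h i (x i).

Definition shapka_value (d : nat) (n : 'I_d -> nat) (f : grid n -> 'F_2)
    (a b : grid n) : 'F_2 :=
  f b + \sum_(j < d) f (replace_coord a b j) + (if odd d then 0 else f a).

(* A uniform pair in the product is a pair of independent uniform points. *)
Definition shapka_reject_prob (d : nat) (n : 'I_d -> nat) (f : grid n -> 'F_2) :
    rat :=
  prob [pred ab : grid n * grid n | shapka_value f ab.1 ab.2 == 1].

(* Main.v *)
Require Import Defs.
From mathcomp Require Import all_boot all_order all_algebra.

Set Implicit Arguments.
Unset Strict Implicit.
Unset Printing Implicit Defensive.

Import GRing.Theory Num.Theory.
Local Open Scope ring_scope.

(** For fixed [a], the test accepts [(a, b)] exactly when [f b] agrees with
    [shapka_decoder f a b], and the latter is a direct sum in [b] because its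
    [j]-th term depends on [b] only through [b j].  The rejection probability
    is the average over [a] of the distance from [f] to this direct sum, so the
    best [a] does at least as well. *)

Definition shapka_decoder (d : nat) (n : 'I_d -> nat) (f : grid n -> 'F_2)
    (a b : grid n) : 'F_2 :=
  \sum_(j < d) f (replace_coord a b j) + (if odd d then 0 else f a).

Lemma F2_add_eq1 (x y : 'F_2) : (x + y == 1) = (x != y).
Proof. by case: x => [[|[|?]] ?]; case: y => [[|[|?]] ?]. Qed.

Lemma shapka_value_eq1 (d : nat) (n : 'I_d -> nat) (f : grid n -> 'F_2)
    (a b : grid n) :
  (shapka_value f a b == 1) = (f b != shapka_decoder f a b).
Proof. by rewrite /shapka_value -addrA F2_add_eq1. Qed.

Lemma shapka_decoder_direct_sum (d : nat) (n : 'I_d -> nat)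
    (f : grid n -> 'F_2) (a : grid n) :
  (0 < d)%N -> direct_sum (shapka_decoder f a).
Proof.
move=> d_gt0; pose i0 := Ordinal d_gt0; pose c := if odd d then 0 else f a.
(* The term [c] does not depend on [x], so it is charged to the single coordinate [i0], which exists
   because [d] is positive; [dfwith a y] is [a] with coordinate [i] set to [y]. *)
exists (fun i y => f (finfun (dfwith a y)) + (if i == i0 then c else 0)) => x.
rewrite big_split -big_mkcond big_pred1_eq; congr (_ + _).
apply: eq_bigr => i _; congr f; apply/ffunP => k; rewrite !ffunE.
have [->|neq_ki] := eqVneq k i; first by rewrite dfwith_in.
by rewrite dfwith_out // eq_sym.
Qed.

(** Averaging: the right side is the mean over [a] of [prob (P a)], and a minimum is at most the
    mean. The point [a0] makes [S] nonempty. *)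
Lemma exists_prob_section_le (S T : finType) (a0 : S) (P : S -> pred T) :
  exists a, prob (P a) <= prob [pred ab : S * T | P ab.1 ab.2].
Proof.
pose a := [arg min_(a < a0) #|P a|].
have a_min b : (#|P a| <= #|P b|)%N.
  by rewrite /a; case: arg_minnP => // c _; apply.
have S_gt0 : (0 < #|S|)%N by apply/card_gt0P; exists a0.
have card_pairs : #|[pred ab : S * T | P ab.1 ab.2]| = (\sum_b #|P b|)%N.
  rewrite -sum1_card; under [RHS]eq_bigr do rewrite -sum1_card.
  by rewrite pair_big_dep.
(* The common factor [#|T|^-1] cancels and [#|S|] is cleared, leaving the sum of the constant
   [#|P a|] over [S] against the sum of all [#|P b|]. *)
exists a; rewrite /prob card_prod natrM invfM mulrA ler_wpM2r ?invr_ge0 //.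
rewrite ler_pdivlMr ?ltr0n // -natrM ler_nat card_pairs mulnC -sum_nat_const.
exact: leq_sum.
Qed.

Theorem theorem3p2 (d : nat) (n : 'I_d -> nat) (f : grid n -> 'F_2)
    (d_gt0 : (0 < d)%N) (n_gt0 : forall i : 'I_d, (0 < n i)%N) :
  exists g : grid n -> 'F_2,
    direct_sum g /\ prob [pred x : grid n | f x != g x] <= shapka_reject_prob f.
Proof.
(* The zero vector serves only to show that the grid is nonempty. *)
have [a a_le] := exists_prob_section_le ([ffun=> ord0] : grid n)
  (fun a => [pred b | f b != shapka_decoder f a b]).
exists (shapka_decoder f a); split; first exact: shapka_decoder_direct_sum.
suff -> : shapka_reject_prob f =
    prob [pred ab : grid n * grid n | f ab.2 != shapka_decoder f ab.1 ab.2].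
  exact: a_le.
by congr (_%:R / _); apply: eq_card => ab; rewrite !inE shapka_value_eq1.
Qed.
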